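(* Let $n\ge 1$, let $N'\subseteq\{1,\dots,n\}$, and for each $i\in N'$ let $\underline{x}_i,\overline{x}_i$ be real numbers with $0<\underline{x}_i<\overline{x}_i$. For $i\in N'$ define $$S^x_i=\{(\tilde{x}_i,x_i)\in\mathbb{R}^2:\ x_i\le e^{\tilde{x}_i},\ \log\underline{x}_i\le\tilde{x}_i\le\log\overline{x}_i,\ \underline{x}_i\le x_i\le\overline{x}_i\}$$ and $$R^x_i=\Big\{(\tilde{x}_i,x_i)\in\mathbb{R}^2:\ x_i\le\frac{\overline{x}_i-\underline{x}_i}{\log\overline{x}_i-\log\underline{x}_i}(\tilde{x}_i-\log\underline{x}_i)+\underline{x}_i,\ \ \tilde{x}_i\le\log\overline{x}_i,\ \ \underline{x}_i\le x_i\Big\}.$$ Then $R^x_i=\operatorname{conv}(S^x_i)$ for all $i\in N'$.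
   Context: $\operatorname{conv}(\cdot)$ denotes the convex hull and $\log$ the natural logarithm. *)

(* Defs.v *)
From mathcomp Require Import all_boot all_order all_algebra.
From mathcomp Require Import all_classical all_reals all_analysis.

Set Implicit Arguments.
Unset Strict Implicit.
Unset Printing Implicit Defensive.

Import Order.TTheory GRing.Theory Num.Theory.

Local Open Scope classical_set_scope.
Local Open Scope ring_scope.

(* [smallest C A] is the intersection of all supersets of A satisfying C. *)
Definition convex_hull (R : numDomainType) (M : lmodType R) (A : set M) : set M :=
  smallest (@convex_set R M) A.

(* [R^o] equips the plane with its R-module structure. A point p has p.1 as
   its logarithmic coordinate and p.2 as its original coordinate; [lx] and
   [ux] are the lower and upper bounds. *)
Definition Sx (R : realType) (lx ux : R) : set (R^o * R^o)%type :=
  [set p | [/\ p.2 <= expR p.1,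
               ln lx <= p.1 <= ln ux
             & lx <= p.2 <= ux]].

Definition Rx (R : realType) (lx ux : R) : set (R^o * R^o)%type :=
  [set p | [/\ p.2 <= (ux - lx) / (ln ux - ln lx) * (p.1 - ln lx) + lx,
               p.1 <= ln ux
             & lx <= p.2]].

(* Main.v *)
Require Import Defs.
From mathcomp Require Import all_boot all_order all_algebra.
From mathcomp Require Import all_classical all_reals all_analysis.
From mathcomp Require Import ring lra.

(** Write [a = ln lx] and [b = ln ux].  The set [Rx lx ux] is the triangle with
    vertices [(a, lx)], [(b, lx)] and [(b, ux)]: its hypotenuse is the chord of
    the exponential over [[a, b]].

    The exponential is convex, hence lies below this chord, so the triangle
    contains [Sx lx ux] ([Sx_sub_Rx]); being convex ([convex_Rx]), it contains
    the hull.

    Conversely, cut the triangle by vertical segments.  The segment at abscissa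
    [s] runs from the point [(s, lx)], which lies in [Sx lx ux] because
    [lx = expR a <= expR s], up to the point of abscissa [s] on the hypotenuse,
    which is a convex combination of the two points [(a, lx)] and [(b, ux)] of
    the graph of the exponential.  So every point of the triangle is reached
    from [Sx lx ux] by two successive convex combinations ([Rx_sub_hull]). *)

Set Implicit Arguments.
Unset Strict Implicit.
Unset Printing Implicit Defensive.

Import Order.TTheory GRing.Theory Num.Theory.

Local Open Scope classical_set_scope.
Local Open Scope ring_scope.
Local Open Scope convex_scope.

(** An intersection of convex sets is convex. *)
Lemma convex_convex_hull (R : numDomainType) (M : lmodType R) (A : set M) :
  convex_set (convex_hull A).
Proof.
move=> x y t; rewrite !in_setE => Ax Ay C [Cconv AC].
by rewrite -in_setE; apply: (Cconv); apply: mem_set; [exact: Ax|exact: Ay].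
Qed.

(** The degenerate case [a = b] is included; any coefficient then works. *)
Lemma itv_conv_ex (R : realFieldType) (a b x : R) : a <= x <= b ->
  exists t : {i01 R}, x = t%:num * b + (1 - t%:num) * a.
Proof.
case/andP=> ax xb; have [ab|ab] := eqVneq a b.
  exists 0%:i01 => /=; lra.
have ltab : a < b by rewrite lt_neqAle ab (le_trans ax xb).
have t0 : 0 <= (x - a) / (b - a) by rewrite divr_ge0 ?subr_ge0 // ltW.
have t1 : (x - a) / (b - a) <= 1 by rewrite ler_pdivrMr ?subr_gt0 //; lra.
exists (Itv01 t0 t1) => /=; field; lra.
Qed.

Lemma convex_set_conv2 (R : numDomainType) (A : set (R^o * R^o)%type)
    (t : {i01 R}) (x1 x2 y1 y2 : R) :
  convex_set A -> A (x1, x2) -> A (y1, y2) ->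
  A (t%:num * x1 + (1 - t%:num) * y1, t%:num * x2 + (1 - t%:num) * y2).
Proof.
move=> Aconv Ax Ay.
have := Aconv (x1, x2) (y1, y2) t; rewrite !in_setE; exact.
Qed.

Section Triangle.
Variables (R : realType) (lx ux : R).
Hypotheses (lx0 : 0 < lx) (lxux : lx < ux).

Let lnlu : ln lx < ln ux.
Proof. by rewrite ltr_ln ?posrE // (lt_trans lx0). Qed.

Let explx : expR (ln lx) = lx. Proof. exact: lnK. Qed.

Let expux : expR (ln ux) = ux.
Proof. by rewrite lnK // posrE (lt_trans lx0). Qed.

Lemma convex_Rx : convex_set (Rx lx ux).
Proof.
move=> [x1 x2] [y1 y2] t; rewrite !in_setE /Rx /=.
move=> [xc xb xl] [yc yb yl].
(* Each constraint is affine, so averaging the constraints at the two points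
   yields the constraint at their average. *)
have avg (u u' v v' : R) : u <= u' -> v <= v' ->
    t%:num * u + (1 - t%:num) * v <= t%:num * u' + (1 - t%:num) * v'.
  by move=> uu' vv'; rewrite lerD // ler_wpM2l // subr_ge0.
split.
- by apply: (le_trans (avg _ _ _ _ xc yc)); rewrite /GRing.scale /= /unstable.onem; lra.
- by apply: (le_trans (avg _ _ _ _ xb yb)); lra.
- by apply: (le_trans _ (avg _ _ _ _ xl yl)); lra.
Qed.

(** The abscissa dividing [[ln lx, ln ux]] in a given ratio is where the chord
    divides [[lx, ux]] in the same ratio: this is what lets the bound defining
    [Rx] be compared with convex combinations of the two end points. *)
Lemma chord_conv (t : R) :
  (ux - lx) / (ln ux - ln lx) * (t * ln ux + (1 - t) * ln lx - ln lx) + lx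
  = t * ux + (1 - t) * lx.
Proof. by field; rewrite subr_eq0 gt_eqF. Qed.

(** Convexity of the exponential: it lies below the chord. *)
Lemma Sx_sub_Rx : Sx lx ux `<=` Rx lx ux.
Proof.
move=> [x1 x2]; rewrite /Sx /Rx /= => -[xe x1itv /andP[xl _]].
split=> //; last by case/andP: x1itv.
have [t x1E] := itv_conv_ex x1itv; apply: (le_trans xe).
rewrite x1E chord_conv -{2}expux -{2}explx.
exact: (convex_expR t (ln ux) (ln lx)).
Qed.

(** On the vertical line through a point of the triangle, the hull contains both
    the foot [(s, lx)] and the point of the hypotenuse, hence what lies between
    them.  Degenerate segments need no separate treatment, as
    [itv_conv_ex] covers intervals reduced to a point. *)
Lemma Rx_sub_hull : Rx lx ux `<=` convex_hull (Sx lx ux).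
Proof.
move=> [s x]; rewrite /Rx /= => -[xc sb xl].
have Sl (r : R) : ln lx <= r <= ln ux -> convex_hull (Sx lx ux) (r, lx).
  move=> /andP[ar rb]; apply: sub_gen_smallest; split=> /=.
  - by rewrite -explx ler_expR.
  - exact/andP.
  - by rewrite lexx ltW.
have Su : convex_hull (Sx lx ux) (ln ux, ux).
  apply: sub_gen_smallest; split=> /=.
  - by rewrite expux.
  - by rewrite lexx andbT ltW.
  - by rewrite lexx andbT ltW.
(* The chord has positive slope, so lying above [lx] and below the chord bounds
   the abscissa from below. *)
have sge : ln lx <= s.
  have m0 : 0 < (ux - lx) / (ln ux - ln lx) by rewrite divr_gt0 // subr_gt0.
  by rewrite -subr_ge0 -(pmulr_rge0 _ m0) -(lerD2r lx) add0r (le_trans xl).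
have sitv : ln lx <= s <= ln ux by apply/andP.
have [t sE] := itv_conv_ex sitv.
(* The hypotenuse point over [s], with the weights that give the abscissa [s]. *)
have top : convex_hull (Sx lx ux) (s, t%:num * ux + (1 - t%:num) * lx).
  rewrite {1}sE; apply: (convex_set_conv2 t (@convex_convex_hull _ _ _)) => //.
  by apply: Sl; rewrite lexx ltW.
have xitv : lx <= x <= t%:num * ux + (1 - t%:num) * lx.
  by rewrite xl -chord_conv -sE.
have [w ->] := itv_conv_ex xitv.
(* Both ends of the vertical segment have abscissa [s]. *)
have -> : s = w%:num * s + (1 - w%:num) * s by ring.
exact: (convex_set_conv2 w (@convex_convex_hull _ _ _) top (Sl _ sitv)).
Qed.

End Triangle.

Theorem proposition2 (R : realType) (n : nat) (hn : (1 <= n)%N)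
    (N' : {set 'I_n}) (lx ux : 'I_n -> R)
    (hx : forall i : 'I_n, i \in N' -> 0 < lx i /\ lx i < ux i) :
  forall i : 'I_n, i \in N' ->
    Rx (lx i) (ux i) = convex_hull (Sx (lx i) (ux i)).
Proof.
move=> i /hx[lx0 lxux]; apply/seteqP; split; first exact: Rx_sub_hull.
by apply: smallest_sub; [exact: convex_Rx|exact: Sx_sub_Rx].
Qed.
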